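(* Let $(g_n,h_n)_{n=0}^\infty$ be a framing for $\mathcal F$ in the complex Hilbert space $\mathcal H$, where $\mathcal F\neq\{0\}$ is a linear subspace of $\mathcal H$. Let $A$ and $B$ be closed operators, densely defined in $\mathcal H$, such that $g_n\in\mathcal D(A)$ and $h_n\in\mathcal D(B)$ for all $n\geq 0$. Let $\mathcal D_B\subset\mathcal D(B^* )$ be a linear subspace which is dense in $\mathcal H$. Suppose that $$\mathcal F\subset\mathcal F_A:=\{g\in\mathcal H:\ g\in\mathcal D(A^* )\ \text{and}\ A^*g\in\mathcal F_{max}\}$$ and $$\langle A^*f,B^*h\rangle=\langle f,h\rangle\quad\text{for all } f\in\mathcal F,\ h\in\mathcal D_B .$$ Then for every $f\in\mathcal F$ $$\langle f,h\rangle=\lim_{N\to\infty}\Big\langle\sum_{n=0}^{N}\langle A^*f,g_n\rangle Bh_n,\,h\Big\rangle\quad\text{for all } h\in\mathcal D_B .$$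
   Context: $\mathcal H$ is a complex Hilbert space with inner product $\langle\cdot,\cdot\rangle$ linear in the first variable. Operators are linear and possibly unbounded; $\mathcal D(T)$ is the domain of $T$ and $T^*$ its adjoint. A pair of sequences $(g_n)_{n=0}^\infty$, $(h_n)_{n=0}^\infty$ in $\mathcal H$, written $(g_n,h_n)_{n=0}^\infty$, is a framing in $\mathcal H$ if $f=\sum_{n=0}^\infty\langle f,g_n\rangle h_n$ with unconditional norm convergence holds for at least one nonzero $f\in\mathcal H$. $\mathcal F_{max}$ denotes the linear subspace of all $f\in\mathcal H$ for which this expansion holds unconditionally. $(g_n,h_n)_{n=0}^\infty$ is a framing for a linear subspace $\mathcal F$ if $\mathcal F\subset\mathcal F_{max}$. *)

(* Defs.v *)
From HB Require Import structures.
From mathcomp Require Import all_boot all_order all_algebra.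
From mathcomp Require Import complex.
From mathcomp Require Import all_classical all_reals all_analysis.

Set Implicit Arguments.
Unset Strict Implicit.
Unset Printing Implicit Defensive.

Import Order.TTheory GRing.Theory Num.Theory.
Import numFieldNormedType.Exports.
Local Open Scope classical_set_scope.
Local Open Scope ring_scope.
Local Open Scope complex_scope.

(* A complex Hilbert space is a [completeNormedModType R[i]] [H] together with
   a positive definite Hermitian form [ip : {dot H for Num.conj}] inducing its
   norm.  The library's form is linear in its first variable and
   conjugate-linear in the second. *)
Definition induces_norm (R : realType) (H : completeNormedModType R[i])
    (ip : {dot H for (@Num.conj R[i])}) : Prop :=
  forall x : H, `|x| ^+ 2 = ip x x.

Section Operators.
Context {R : realType} {H : completeNormedModType R[i]}.

Definition linear_subspace (F : set H) : Prop := submod_closed [in F].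

(* The values of [op_fun] outside [op_dom] are meaningless. *)
Record operator := Operator {
  op_dom : set H;
  op_fun :> H -> H;
  op_dom_subspace : linear_subspace op_dom;
  op_linear : forall (a : R[i]) (x y : H), op_dom x -> op_dom y ->
    op_fun (a *: x + y) = a *: op_fun x + op_fun y }.

Definition op_graph (T : operator) : set (H * H) :=
  [set z | op_dom T z.1 /\ z.2 = T z.1].

Definition closed_op (T : operator) : Prop := closed (op_graph T).

Definition densely_defined (T : operator) : Prop := dense (op_dom T).

Variable ip : {dot H for (@Num.conj R[i])}.

Definition adj_rel (T : operator) (y z : H) : Prop :=
  forall x, op_dom T x -> ip (T x) y = ip x z.

Definition adj_dom (T : operator) : set H := [set y | exists z, adj_rel T y z].

(* For densely defined [T] and [y] in [adj_dom T], the vector [z] such that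
   [adj_rel T y z] is unique; outside [adj_dom T] the value is the default 0. *)
Definition adj (T : operator) (y : H) : H := xget 0 [set z | adj_rel T y z].

End Operators.

Section Framings.
Context {R : realType} {H : completeNormedModType R[i]}.

Definition sums_unconditionally (u : nat -> H) (f : H) : Prop :=
  series u @ \oo --> f /\
  forall s : nat -> nat, bijective s -> cvgn (series (u \o s)).

Variable ip : {dot H for (@Num.conj R[i])}.

Definition Fmax (g h : nat -> H) : set H :=
  [set f | sums_unconditionally (fun n => ip f (g n) *: h n) f].

Definition framing (g h : nat -> H) : Prop :=
  exists2 f, f != 0 & Fmax g h f.

Definition framing_for (g h : nat -> H) (F : set H) : Prop :=
  F `<=` Fmax g h.

Lemma framing_for_framing g h F :
  linear_subspace F -> F <> [set 0] -> framing_for g h F -> framing g h.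
Proof.
move=> [F0 _] Fneq0 Fgh.
suff [f Ff f0] : exists2 f, F f & f != 0 by exists f => //; exact: Fgh.
apply: contra_notP Fneq0 => nF; apply/seteqP; split=> [f Ff|_ ->].
  by apply: contra_notP nF => /eqP f0; exists f.
by rewrite inE in F0.
Qed.

Definition F_op (g h : nat -> H) (A : operator) : set H :=
  [set f | adj_dom ip A f /\ Fmax g h (adj ip A f)].

End Framings.

(* Main.v *)
Require Import Defs.
From HB Require Import structures.
From mathcomp Require Import all_boot all_order all_algebra.
From mathcomp Require Import complex.
From mathcomp Require Import all_classical all_reals all_analysis.
Set Implicit Arguments.
Unset Strict Implicit.
Unset Printing Implicit Defensive.
Import Order.TTheory GRing.Theory Num.Theory.
Import numFieldNormedType.Exports.
Local Open Scope classical_set_scope.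
Local Open Scope ring_scope.
Local Open Scope complex_scope.

(** Since [f] lies in [F_op ip g h A], the framing expansion of $A^*f$ converges to it in norm.
    Pairing its partial sums with the fixed vector $B^*k$ is continuous by Cauchy-Schwarz, so the
    pairings tend to $\langle A^*f,B^*k\rangle=\langle f,k\rangle$. Each partial sum is finite, so
    the adjoint relation turns these pairings into those of the theorem; $B$ is never passed through
    a limit. *)

(** Cauchy-Schwarz by projection: [a *: z] is the component of [x] along [z], no longer than [x],
    and $|\langle x,z\rangle|=|a|\,\|z\|^2=\|az\|\,\|z\|$. *)
Lemma ip_le_norm (R : realType) (H : completeNormedModType R[i])
    (ip : {dot H for (@Num.conj R[i])}) (ip_norm : induces_norm ip) (x z : H) :
  `|ip x z| <= `|x| * `|z|.
Proof.
have [->|z0] := eqVneq z 0; first by rewrite linear0r !normr0 mulr0.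
have zz0 : ip z z != 0 by rewrite dnorm_eq0.
pose a := ip x z / ip z z; pose u := x - a *: z.
have uz : ip u z = 0.
  by rewrite linearBl/= linearZl_LR/= divfK// subrr.
have le_az : `|a *: z| <= `|x|.
  rewrite -(ler_pXn2r (ltn0Sn 1)) ?nnegrE// !ip_norm.
  (* Pythagoras for [x = u + a *: z]; the term [ip u u] is nonnegative. *)
  rewrite -[in leRHS](subrK (a *: z) x) -/u.
  by rewrite hnormDd ?lerDr//= linearZr_LR/= uz mulr0.
rewrite -(divfK zz0 (ip x z)) -/a normrM -ip_norm normrX normr_id.
by rewrite expr2 mulrA -normrZ ler_wpM2r.
Qed.

Lemma ip_continuousl (R : realType) (H : completeNormedModType R[i])
    (ip : {dot H for (@Num.conj R[i])}) (ip_norm : induces_norm ip) (z : H) :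
  continuous (fun x => ip x z : R[i]^o).
Proof.
move=> x; apply/(@cvgrPdist_lt _ _ _ (nbhs x)) => e e0; near=> y.
rewrite -[X in `|X|]linearBl (le_lt_trans (ip_le_norm ip_norm _ _))//.
(* The added 1 keeps the divisor of [e] positive even when [z] is 0. *)
apply: (@le_lt_trans _ _ (`|x - y| * (`|z| + 1))).
  by rewrite ler_wpM2l// lerDl.
rewrite -ltr_pdivlMr ?ltr_wpDl//.
by near: y; apply: cvgr_dist_lt => //; rewrite divr_gt0// ltr_wpDl.
Unshelve. all: by end_near. Qed.

Lemma adj_dom_adj (R : realType) (H : completeNormedModType R[i])
    (ip : {dot H for (@Num.conj R[i])}) (T : @operator R H) (y : H) :
  adj_dom ip T y -> adj_rel ip T y (adj ip T y).
Proof. by case=> z Tyz; exact: (xgetPex 0 (ex_intro _ z Tyz)). Qed.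

Theorem lemma2 (R : realType) (H : completeNormedModType R[i])
    (ip : {dot H for (@Num.conj R[i])}) (ip_norm : induces_norm ip)
    (g h : nat -> H)
    (F : set H) (F_sub : linear_subspace F) (F_neq0 : F <> [set 0])
    (F_framing : framing_for ip g h F)
    (A B : @operator R H)
    (A_closed : closed_op A) (A_dense : densely_defined A)
    (B_closed : closed_op B) (B_dense : densely_defined B)
    (g_dom : forall n, op_dom A (g n)) (h_dom : forall n, op_dom B (h n))
    (DB : set H) (DB_sub : linear_subspace DB) (DB_adj : DB `<=` adj_dom ip B)
    (DB_dense : dense DB)
    (F_sub_FA : F `<=` F_op ip g h A)
    (AB_dual : forall f k, F f -> DB k ->
       ip (adj ip A f) (adj ip B k) = ip f k) :
  forall f, F f -> forall k, DB k ->
    (ip (\sum_(0 <= n < N.+1) ip (adj ip A f) (g n) *: B (h n)) k : R[i]^o)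
      @[N --> \oo] --> (ip f k : R[i]^o).
Proof.
move=> f Ff k DBk.
(* [series u N] stops before index [N], whereas the sum in the goal includes it; hence the shift. *)
have [_ []] := F_sub_FA _ Ff; rewrite -cvg_shiftS => cvgAf _.
have sumE N : ip (\sum_(0 <= n < N.+1) ip (adj ip A f) (g n) *: B (h n)) k =
    ip (series (fun n => ip (adj ip A f) (g n) *: h n) N.+1) (adj ip B k).
  rewrite !linear_sumlz; apply: eq_bigr => n _.
  by rewrite !linearZl_LR/= (adj_dom_adj (DB_adj _ DBk) (h_dom n)).
rewrite (funext sumE) -(AB_dual _ _ Ff DBk).
exact: continuous_cvg (@ip_continuousl _ _ _ ip_norm (adj ip B k) _) cvgAf.
Qed.
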